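(* Let $\mathfrak{B}$ be a bornology with a closed base on a topological space $X$. The following are equivalent. (1) $X$ satisfies $\alpha_2(\mathcal{O}_{\mathfrak{B}},\boldsymbol{\Gamma}_{\mathfrak{B}})$. (2) $X$ satisfies $\alpha_3(\mathcal{O}_{\mathfrak{B}},\boldsymbol{\Gamma}_{\mathfrak{B}})$. (3) $X$ satisfies $\alpha_4(\mathcal{O}_{\mathfrak{B}},\boldsymbol{\Gamma}_{\mathfrak{B}})$. (4) $X$ satisfies $S_1(\mathcal{O}_{\mathfrak{B}},\boldsymbol{\Gamma}_{\mathfrak{B}})$. (5) ONE has no winning strategy in the game $G_1(\mathcal{O}_{\mathfrak{B}},\boldsymbol{\Gamma}_{\mathfrak{B}})$. (6) $X$ satisfies $\bigcap_\infty(\mathcal{O}_{\mathfrak{B}},\boldsymbol{\Gamma}_{\mathfrak{B}})$.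
   Context: A bornology $\mathfrak{B}$ on $X$ is a family of subsets of $X$ that is closed under taking subsets and finite unions and covers $X$; by standing convention $X\notin\mathfrak{B}$. A base of $\mathfrak{B}$ is a subfamily $\mathfrak{B}_0\subseteq\mathfrak{B}$ such that every $B\in\mathfrak{B}$ is contained in some $B_0\in\mathfrak{B}_0$; it is closed if its members are closed subsets of $X$. $\mathcal{O}_{\mathfrak{B}}$ is the collection of all open $\mathfrak{B}$-covers of $X$: families $\mathcal{U}$ of open subsets of $X$ with $X\notin\mathcal{U}$ such that every $B\in\mathfrak{B}$ is contained in some $U\in\mathcal{U}$. A cover $\mathcal{U}=\{U_n:n\in\omega\}$ of $X$ by (arbitrary) subsets of $X$ is a $\mathfrak{B}$-sequence if it is infinite and for each $B\in\mathfrak{B}$ there is $n_0\in\omega$ with $B\subseteq U_n$ for all $n\ge n_0$. $\boldsymbol{\Gamma}_{\mathfrak{B}}$ (boldface) is the collection of all $\mathfrak{B}$-sequences of $X$. When membership in $\boldsymbol{\Gamma}_{\mathfrak{B}}$ of a family displayed as $\{W_n:n\in\omega\}$ is asserted, the displayed indexing is the one used. For collections $\mathcal{A},\mathcal{B}$ of families of subsets of $X$: $S_1(\mathcal{A},\mathcal{B})$: for each sequence $\{\mathcal{U}_n:n\in\omega\}$ of elements of $\mathcal{A}$ there are $V_n\in\mathcal{U}_n$ with $\{V_n:n\in\omega\}\in\mathcal{B}$. $G_1(\mathcal{A},\mathcal{B})$: in round $n\in\omega$ player ONE chooses $\mathcal{U}_n\in\mathcal{A}$ and TWO responds with $V_n\in\mathcal{U}_n$;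 TWO wins if $\{V_n:n\in\omega\}\in\mathcal{B}$, otherwise ONE wins. $\bigcap_\infty(\mathcal{A},\mathcal{B})$: for each sequence $\{\mathcal{U}_n:n\in\omega\}$ of elements of $\mathcal{A}$ there are infinite $\mathcal{V}_n\subseteq\mathcal{U}_n$ ($n\in\omega$) with $\{\bigcap\mathcal{V}_n:n\in\omega\}\in\mathcal{B}$. $\alpha_i(\mathcal{A},\mathcal{B})$ for $i=2,3,4$: for each sequence $\{\mathcal{U}_n:n\in\omega\}$ of elements of $\mathcal{A}$ there is $\mathcal{V}\in\mathcal{B}$ such that, for $i=2$: $\mathcal{U}_n\cap\mathcal{V}$ is infinite for every $n\in\omega$; for $i=3$: $\mathcal{U}_n\cap\mathcal{V}$ is infinite for infinitely many $n\in\omega$; for $i=4$: $\mathcal{U}_n\cap\mathcal{V}$ is nonempty for infinitely many $n\in\omega$. *)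

(* Defs.v *)
From mathcomp Require Import all_boot all_classical topology.

Set Implicit Arguments.
Unset Strict Implicit.
Unset Printing Implicit Defensive.

Local Open Scope classical_set_scope.

Section Bornology.
Variable X : topologicalType.
Implicit Types (BB : set (set X)) (U : set (set X)) (W : nat -> set X).

Record bornology BB : Prop := {
  bornology_sub : forall A B, A `<=` B -> BB B -> BB A;
  bornology_setU : forall A B, BB A -> BB B -> BB (A `|` B);
  bornology_cover : \bigcup_(B in BB) B = setT;
  bornology_proper : ~ BB setT }.

Definition bornology_base BB (BB0 : set (set X)) : Prop :=
  BB0 `<=` BB /\ forall B, BB B -> exists2 B0, BB0 B0 & B `<=` B0.

Definition has_closed_base BB : Prop :=
  exists2 BB0, bornology_base BB BB0 & forall B, BB0 B -> closed B.

Definition open_Bcovers BB : set (set (set X)) :=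
  [set U | [/\ forall A, U A -> open A, ~ U setT &
               forall B, BB B -> exists2 A, U A & B `<=` A]].

(* Infinitude is that of the family {W n : n}, i.e. of the range of W. *)
Definition Bsequence BB : set (nat -> set X) :=
  [set W | [/\ \bigcup_n W n = setT, infinite_set (range W) &
               forall B, BB B ->
                 exists n0, forall n, (n0 <= n)%N -> B `<=` W n]].

(* The unindexed families that can be enumerated as a B-sequence. *)
Definition Bsequence_families BB : set (set (set X)) :=
  [set range W | W in Bsequence BB].

End Bornology.

(* In S1, G1 and cap_infty the target collection is tested on the family with
   its displayed indexing, so it is a set of sequences; in alpha2, alpha3 and
   alpha4 it is a set of unindexed families. *)
Section SelectionPrinciples.
Variable T : Type.
Implicit Types (AA CC : set (set (set T))) (SS : set (nat -> set T)).

Definition S1 AA SS : Prop :=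
  forall U : nat -> set (set T), (forall n, AA (U n)) ->
  exists2 V : nat -> set T, (forall n, U n (V n)) & SS V.

(* A strategy of ONE maps the list of the previous moves of TWO to the next
   move of ONE; mkseq V n is [:: V 0; ...; V n.-1]. *)
Definition ONE_winning_strategy AA SS (sigma : seq (set T) -> set (set T)) :
    Prop :=
  (forall h, AA (sigma h)) /\
  forall V : nat -> set T, (forall n, sigma (mkseq V n) (V n)) -> ~ SS V.

Definition ONE_has_winning_strategy_G1 AA SS : Prop :=
  exists sigma, ONE_winning_strategy AA SS sigma.

Definition cap_infty AA SS : Prop :=
  forall U : nat -> set (set T), (forall n, AA (U n)) ->
  exists V : nat -> set (set T),
    (forall n, V n `<=` U n /\ infinite_set (V n)) /\
    SS (fun n => \bigcap_(A in V n) A).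

Definition alpha2 AA CC : Prop :=
  forall U : nat -> set (set T), (forall n, AA (U n)) ->
  exists2 V, CC V & forall n, infinite_set (U n `&` V).

Definition alpha3 AA CC : Prop :=
  forall U : nat -> set (set T), (forall n, AA (U n)) ->
  exists2 V, CC V & infinite_set [set n | infinite_set (U n `&` V)].

Definition alpha4 AA CC : Prop :=
  forall U : nat -> set (set T), (forall n, AA (U n)) ->
  exists2 V, CC V & infinite_set [set n | U n `&` V !=set0].

End SelectionPrinciples.

(* Main.v *)
Require Import Defs.
From mathcomp Require Import all_boot all_classical topology.

Set Implicit Arguments.
Unset Strict Implicit.
Unset Printing Implicit Defensive.

Local Open Scope classical_set_scope.

(** Call the members of the bornology bounded, and open B-covers just covers.
Selecting one member [V n] from each cover [U n] yields a B-sequence as soon as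
every bounded set is eventually contained in [V n]: since no [V n] is the whole
space, infinitude of the range is automatic.  The property S1 is the hub of the
equivalence.

S1 implies the rest through reindexing.  It selects along any countable index
type, every bounded set being contained in all but finitely many of the selected
sets.  Over pairs [(n, i)], with the cover [U n] used for every [i], the
sets selected for a fixed [n] are infinitely many, which gives both alpha2 and
the intersection principle.  Over finite sequences of integers, it selects
simultaneously an answer at every position of the tree of plays against a given
strategy of ONE, after ONE's moves have been thinned out to countable covers;
the branch that follows the selected answers meets each position at most once, so
it is won by TWO.

The converses from the game and from the intersection principle are direct.  The
delicate one is alpha4 -> S1, because the family given by alpha4 may meet all
the covers in one and the same member.  This cannot happen when every set
belongs to only finitely many of the covers (lemma [alpha4_selection]), so the
covers have to be separated, and this is done twice.
- Complements of closures of [n.+1] points with pairwise disjoint closures form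
  a cover, because closures of points are bounded when there is a closed
  base.  Such a closure determines the number of its points, so that different
  [n] give disjoint covers.  Hence there is a countable cover [O m] that
  eventually contains every bounded set.
- Fix points [d m] outside [O m].  Given covers [U n], consider the open sets
  that lie in some [O m] and in some member of each of [U 0], ..., [U n], and
  that contain [d 0], ..., [d n].
  They form a cover, and a set inside [O m] misses [d m], hence belongs to
  no cover of index at least [m].  Enlarging what is selected from these
  covers gives a selection from the [U n]. *)

(** * Sequences of indices *)

Lemma infinite_nat_unbounded (N : set nat) :
  infinite_set N -> forall k, exists2 n, N n & (k <= n)%N.
Proof.
move=> Ninf k; apply: contrapT => bnd; apply: Ninf.
apply: (sub_finite_set _ (finite_II k)) => n Nn /=.
by rewrite ltnNge; apply/negP => kn; case: bnd; exists n.
Qed.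

Section Tendsto.
Variables (T : Type) (q p : T -> nat).

(** The parameter [q] measures how far an index is: it is the identity for
sequences, and the first projection for double sequences, for which the
conclusion is uniform in the second index. *)
Lemma bounded_fibers_tendsto :
  (forall m, exists M, forall t, p t = m -> (q t < M)%N) ->
  forall n0, exists N, forall t, (N <= q t)%N -> (n0 <= p t)%N.
Proof.
move=> fib; elim=> [|n0 [N HN]]; first by exists 0.
have [M HM] := fib n0; exists (maxn N M) => t.
rewrite geq_max => /andP[Nt Mt]; rewrite ltn_neqAle HN // andbT.
by apply/eqP => /esym /HM; rewrite ltnNge Mt.
Qed.

Lemma injective_tendsto :
  injective p -> forall n0, exists N, forall t, (N <= q t)%N -> (n0 <= p t)%N.
Proof.
move=> pinj; apply: bounded_fibers_tendsto => m.
have [[t0 pt0]|no] := pselect (exists t, p t = m).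
  by exists (q t0).+1 => t; rewrite -pt0 => /pinj ->.
by exists 0 => t pt; case: no; exists t.
Qed.

End Tendsto.

(** * Bornologies, covers and sequences *)

Lemma not_setT_missed (T : Type) (A : set T) : A <> setT -> exists x, ~ A x.
Proof. by move=> /eqP/setTPn. Qed.

Section Covers.
Variables (X : topologicalType) (BB : set (set X)).
Hypothesis hBB : bornology BB.

Definition eventually_contains (W : nat -> set X) : Prop :=
  forall B, BB B -> exists n0, forall n, (n0 <= n)%N -> B `<=` W n.

Lemma bornology_set1 x : BB [set x].
Proof.
have : setT x by [].
rewrite -(bornology_cover hBB) => -[B BBB Bx].
by apply: (bornology_sub hBB _ BBB) => y ->.
Qed.

(** The point [x] is there because the empty family is a bornology on the empty
space. *)
Lemma bornology_finite (x : X) (F : set X) : finite_set F -> BB F.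
Proof.
move=> /finite_seqP[s ->]; elim: s => [|y s IH].
  by apply: (bornology_sub hBB _ (bornology_set1 x)) => y.
apply: (bornology_sub hBB _ (bornology_setU hBB (bornology_set1 y) IH)).
by move=> z /=; rewrite inE => /predU1P[]; [left|right].
Qed.

(** If the range were finite, so would be a set meeting the complement of every
term; such a set is bounded, hence is contained in some term. *)
Lemma eventually_contains_Bsequence (W : nat -> set X) :
  (forall n, W n <> setT) -> eventually_contains W -> Bsequence BB W.
Proof.
move=> WT Wev.
have [x0 _] := not_setT_missed (WT 0).
have missed (A : set X) : exists x, A <> setT -> ~ A x.
  have [->|/not_setT_missed[x ?]] := pselect (A = setT); first by exists x0.
  by exists x.
have [c Hc] := choice missed.
split=> //.
- apply/seteqP; split=> // x _.
  have [n0 Hn0] := Wev _ (bornology_set1 x).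
  by exists n0 => //; apply: (Hn0 n0).
- move=> fin.
  have [n Hn] := Wev _ (bornology_finite x0 (finite_image c fin)).
  apply: (Hc _ (WT n)); apply: (Hn n) => //.
  by exists (W n) => //; exists n.
Qed.

Lemma selection_Bsequence (U : nat -> set (set X)) (W : nat -> set X) :
  (forall n, open_Bcovers BB (U n)) -> (forall n, U n (W n)) ->
  eventually_contains W -> Bsequence BB W.
Proof.
move=> OU UW; apply: eventually_contains_Bsequence => n WT.
by have [_ + _] := OU n; apply; rewrite -WT.
Qed.

Lemma eventually_contains_cover (W : nat -> set X) :
  (forall n, open (W n)) -> (forall n, W n <> setT) ->
  eventually_contains W -> open_Bcovers BB (range W).
Proof.
move=> Wo WT Wev; split=> [A [n _ <-] //|[n _ /WT] //|B /Wev [n Hn]].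
by exists (W n); [exists n|exact: Hn].
Qed.

End Covers.

(** * Consequences of the single selection principle *)

Section SingleSelection.
Variables (X : topologicalType) (BB : set (set X)).
Hypothesis hBB : bornology BB.
Let OB := open_Bcovers BB.
Hypothesis hS1 : S1 OB (Bsequence BB).

Lemma S1_countable (I : countType) (i0 : I) (U : I -> set (set X)) :
  (forall i, OB (U i)) ->
  exists2 W : nat -> set X, Bsequence BB W & forall i, U i (W (pickle i)).
Proof.
move=> OU.
have [W UW Wseq] := hS1 (fun k => OU (odflt i0 (unpickle k))).
by exists W => // i; have := UW (pickle i); rewrite pickleK.
Qed.

(** An injective sequence of indices has codes tending to infinity, so it
inherits the eventual inclusions. *)
Lemma Bsequence_reindex (I : countType) (U : I -> set (set X)) W
    (f : nat -> I) :
  (forall i, OB (U i)) -> Bsequence BB W -> (forall i, U i (W (pickle i))) ->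
  injective f -> Bsequence BB (fun k => W (pickle (f k))).
Proof.
move=> OU [_ _ Wev] UW finj.
apply: (selection_Bsequence hBB (fun k => OU (f k))) => //.
move=> B /Wev [n0 Hn0].
have pfinj : injective (pickle \o f).
  by apply: inj_comp finj; exact: pcan_inj pickleK.
have [N HN] := injective_tendsto id pfinj n0.
by exists N => k /HN /Hn0.
Qed.

Definition pair_code (n i : nat) : nat := pickle ((n, i) : (nat * nat)%type).

(** For fixed [n] the sets [W (pair_code n i)] form a subsequence of [W], hence
again a B-sequence, and B-sequences have infinite range. *)
Lemma S1_infinitely_often (U : nat -> set (set X)) :
  (forall n, OB (U n)) ->
  exists W, [/\ Bsequence BB W,
    forall n i : nat, U n (W (pair_code n i)) &
    forall n, infinite_set (range (fun i : nat => W (pair_code n i)))].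
Proof.
move=> OU; have OU2 (p : nat * nat) := OU p.1.
have [W Wseq UW] := S1_countable (0, 0) OU2.
exists W; split=> // [n i|n]; first exact: UW (n, i).
suff [] : Bsequence BB (fun i => W (pair_code n i)) by [].
by apply: (Bsequence_reindex OU2 Wseq UW (f := pair n)) => i j [].
Qed.

Lemma S1_alpha2 : alpha2 OB (Bsequence_families BB).
Proof.
move=> U /S1_infinitely_often [W [Wseq UW Winf]].
exists (range W) => [|n]; first by exists W.
apply: sub_infinite_set (Winf n) => A [i _ <-].
by split; [exact: UW|exists (pair_code n i)].
Qed.

(** A bounded set is contained in [W (pair_code n i)] for all but finitely many
pairs, hence for every [i] as soon as [n] is large. *)
Lemma S1_cap_infty : cap_infty OB (Bsequence BB).
Proof.
move=> U OU; have [W [[_ _ Wev] UW Winf]] := S1_infinitely_often OU.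
exists (fun n => range (fun i : nat => W (pair_code n i))); split=> [n|].
  by split=> // A [i _ <-]; exact: UW.
apply: eventually_contains_Bsequence => // [n capT|B /Wev [n0 Hn0]].
  have [_ UT _] := OU n; suff WT : W (pair_code n 0) = setT.
    by apply: UT; rewrite -WT.
  apply/seteqP; split=> // x; rewrite -capT; apply.
  by exists 0.
have [N HN] := injective_tendsto fst (pcan_inj (@pickleK (nat * nat)%type)) n0.
by exists N => n Nn x Bx A [i _ <-]; apply: (Hn0 _ (HN (n, i) Nn)).
Qed.

(** A strategy of ONE whose moves were countable would give a countable tree of
positions. S1 applied to a constant sequence provides in each move [sigma h] a
B-sequence [T h], and TWO restricts to answers in it; a position is then
coded by the finite sequence of the indices of TWO's answers. *)
Lemma S1_ONE_has_no_winning_strategy :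
  ~ ONE_has_winning_strategy_G1 OB (Bsequence BB).
Proof.
move=> [sigma [Osigma win]].
have enum h : exists T : nat -> set X,
    (forall n, sigma h (T n)) /\ eventually_contains BB T.
  by have [T UT [_ _ Tev]] := hS1 (fun _ => Osigma h); exists T.
have [T HT] := choice enum.
pose H := foldl (fun h n => rcons h (T h n)) [::].
have H_rcons s n : H (rcons s n) = rcons (H s) (T (H s) n).
  by rewrite /H foldl_rcons.
have OT s : OB (range (T (H s))).
  have [Uo UT _] := Osigma (H s).
  apply: eventually_contains_cover => [n|n Tn|].
  - by apply: Uo; apply: (HT _).1.
  - by apply: UT; rewrite -Tn; apply: (HT _).1.
  - exact: (HT _).2.
have [W Wseq TW] := S1_countable [::] OT.
(* Some answer [c s] at each position [s], chosen once and for all by S1. *)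
have reply s : exists n, T (H s) n = W (pickle s).
  by have [n _] := TW s; exists n.
have [c Hc] := choice reply.
(* The play in which TWO always gives the answer chosen for the position. *)
pose b k := iter k (fun s => rcons s (c s)) [::].
have size_b k : size (b k) = k by elim: k => //= k IH; rewrite size_rcons IH.
have H_b k : H (b k) = mkseq (fun k => W (pickle (b k))) k.
  by elim: k => //= k IH; rewrite mkseqS -IH H_rcons Hc.
apply: (win (fun k => W (pickle (b k)))) => [n|].
  by rewrite -H_b /= -Hc; apply: (HT _).1.
by apply: (Bsequence_reindex OT Wseq TW) => k l /(congr1 size); rewrite !size_b.
Qed.

End SingleSelection.

(** * Recovering the single selection principle *)

Section ToSingleSelection.
Variables (X : topologicalType) (BB : set (set X)).
Let OB := open_Bcovers BB.

(** A sequence of covers is a strategy of ONE that looks only at the number of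
the round. *)
Lemma ONE_has_no_winning_strategy_S1 :
  ~ ONE_has_winning_strategy_G1 OB (Bsequence BB) -> S1 OB (Bsequence BB).
Proof.
move=> noWS U OU; apply: contrapT => noV; apply: noWS.
exists (fun h => U (size h)); split=> // V UV Vseq; apply: noV.
by exists V => // n; have := UV n; rewrite size_mkseq.
Qed.

Lemma cap_infty_S1 (hBB : bornology BB) :
  cap_infty OB (Bsequence BB) -> S1 OB (Bsequence BB).
Proof.
move=> cap U OU; have [V [UV [_ _ Vev]]] := cap U OU.
have nonempty n : exists A, V n A.
  apply: contrapT => /forallNP V0; apply: (UV n).2.
  by rewrite (_ : V n = set0) //; apply/seteqP; split=> A // /V0.
have [W VW] := choice nonempty.
have UW n : U n (W n) by apply: (UV n).1.
exists W => //; apply: (selection_Bsequence hBB OU UW) => B /Vev [n0 Hn0].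
by exists n0 => n /Hn0 Bn x /Bn; apply.
Qed.

End ToSingleSelection.

(** * From alpha4 to single selections *)

Section Alpha4.
Variables (X : topologicalType) (BB : set (set X)).
Hypotheses (hBB : bornology BB) (hcl : has_closed_base BB).
Let OB := open_Bcovers BB.
Hypothesis hA4 : alpha4 OB (Bsequence_families BB).

(** Since each [W m] lies in finitely many covers, members of the B-sequence [W]
that belong to later and later covers must have indices tending to infinity. *)
Lemma alpha4_selection (V : nat -> set (set X)) :
  (forall n, OB (V n)) ->
  (forall A, exists M, forall n, V n A -> (n < M)%N) ->
  exists2 A : nat -> set X, eventually_contains BB A &
    forall k, exists2 n, V n (A k) & (k <= n)%N.
Proof.
move=> OV Vfin; have [_ [W [_ _ Wev] <-] Ninf] := hA4 OV.
have late k : exists p, [/\ V p.1 (W p.2) & (k <= p.1)%N].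
  have [n [A [VA [j _ WA]]] kn] := infinite_nat_unbounded Ninf k.
  by exists (n, j); rewrite /= WA.
have [p Hp] := choice late.
have pW m : exists M, forall k, (p k).2 = m -> (k < M)%N.
  have [M HM] := Vfin (W m); exists M => k pk.
  have [VW kp] := Hp k; apply: leq_ltn_trans kp (HM _ _).
  by rewrite -pk.
exists (fun k => W (p k).2) => [B /Wev [n0 Hn0]|k]; last first.
  by have [VW kp] := Hp k; exists (p k).1.
have [N HN] := bounded_fibers_tendsto (q := id) pW n0.
by exists N => k /HN /Hn0.
Qed.

Definition finite_closure (s : seq X) : set X :=
  \bigcup_(x in [set` s]) closure [set x].

Definition disjoint_closures (s : seq X) : Prop :=
  uniq s /\ forall x y, x \in s -> y \in s ->
    closure [set x] `&` closure [set y] !=set0 -> x = y.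

Lemma closure_point (x : X) : closure [set x] x.
Proof. exact: subset_closure. Qed.

Lemma closure_point_sub (x y : X) :
  closure [set x] y -> closure [set y] `<=` closure [set x].
Proof.
move=> xy; rewrite [X in _ `<=` X](closure_id _).1; last exact: closed_closure.
by apply: closure_subset => _ ->.
Qed.

(** Each [x] in [s] is in the closure of some [g x] in [t], which is itself in
the closure of some [h] in [s].  Then [x] is in the closure of [h], so [x = h]
by disjointness: [g] is injective. *)
Lemma disjoint_closures_size_le (s t : seq X) :
  disjoint_closures s -> finite_closure s = finite_closure t -> (size s <= size t)%N.
Proof.
move=> [us ds] st.
have sub_t x : x \in s -> exists2 y, y \in t & closure [set y] x.
  move=> xs; have : finite_closure t x.
    by rewrite -st; exists x => //; exact: closure_point.
  by move=> [y yt yx]; exists y.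
have above x : exists y, x \in s -> y \in t /\ closure [set y] x.
  have [/sub_t [y yt yx]|_] := boolP (x \in s); first by exists y.
  by exists x.
have [g Hg] := choice above.
have ginj : {in s &, injective g}.
  move=> x x' xs x's gxx'.
  have [gt gx] := Hg x xs; have [_ gx'] := Hg x' x's; rewrite -gxx' in gx'.
  have : finite_closure s (g x).
    by rewrite st; exists (g x) => //; exact: closure_point.
  move=> [h hs /closure_point_sub hg].
  have -> : x = h.
    by apply: ds => //; exists x; split; [exact: closure_point|exact: hg].
  apply/esym; apply: ds => //.
  by exists x'; split; [exact: closure_point|exact: hg].
rewrite -(size_map g); apply: uniq_leq_size; first by rewrite map_inj_in_uniq.
by move=> _ /mapP[x xs ->]; have [] := Hg x xs.
Qed.

(** A closed base member containing [x] contains the closure of [x]. *)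
Lemma bornology_closure_point (x : X) : BB (closure [set x]).
Proof.
have [BB0 [BB0sub BB0base] BB0cl] := hcl.
have [B0 BB0B0 xB0] := BB0base _ (bornology_set1 hBB x).
apply: (bornology_sub hBB _ (BB0sub _ BB0B0)).
by rewrite (closure_id B0).1; [exact: closure_subset|exact: BB0cl].
Qed.

(** A point outside an open set that contains [B] has its closure disjoint from
[B].  Adding this closure to [B], which remains bounded, forces the
closures of the points found next to be disjoint from it. *)
Lemma disjoint_closures_avoiding (U : set (set X)) : OB U ->
  forall n B, BB B -> exists s, [/\ size s = n, disjoint_closures s &
    B `&` finite_closure s = set0].
Proof.
move=> [Uo UT Uc]; elim=> [|n IH] B BBB.
  exists [::]; split=> //.
  by apply/seteqP; split=> // x [_ [y]].
have [A UA BA] := Uc _ BBB.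
have [x nAx] : exists x, ~ A x.
  by apply: not_setT_missed => AT; apply: UT; rewrite -AT.
have BBx := bornology_setU hBB BBB (bornology_closure_point x).
have [s [sn [us ds] Bs]] := IH _ BBx.
have meet_s z y :
    y \in s -> closure [set y] z -> B z \/ closure [set x] z -> False.
  by move=> ys yz BxZ; suff : set0 z by []; rewrite -Bs; split=> //; exists y.
exists (x :: s); split; first by rewrite /= sn.
- split=> [|y z].
    rewrite /= us andbT; apply/negP => xs.
    by apply: (meet_s x x xs); [|right]; exact: closure_point.
  rewrite !inE => /predU1P[->|ys] /predU1P[->|zs] //.
  + by move=> [w [xw zw]]; case: (meet_s w z zs zw); right.
  + by move=> [w [yw xw]]; case: (meet_s w y ys yw); right.
  + exact: ds.
- apply/seteqP; split=> // z [Bz [y /=]].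
  rewrite inE => /predU1P[-> xz|ys yz]; last by case: (meet_s z y ys yz); left.
  have [w [Aw]] := xz A (open_nbhs_nbhs (conj (Uo _ UA) (BA _ Bz))).
  by move=> wx; case: nAx; rewrite -Aw.
Qed.

(** The covers [V n] by complements of closures of [n.+1] points are pairwise
disjoint, so alpha4 has to select from infinitely many of them different sets.
*)
Lemma alpha4_countable_cover (U : set (set X)) : OB U ->
  exists O : nat -> set X, [/\ forall k, open (O k), forall k, O k <> setT &
    eventually_contains BB O].
Proof.
move=> OU.
(* At least one point is removed, since the whole space is in no cover. *)
pose V n : set (set X) := [set A | exists s,
  [/\ size s = n.+1, disjoint_closures s & A = ~` finite_closure s]].
have Vopen n A : V n A -> open A.
  move=> [s [_ _ ->]]; rewrite openC.
  apply: closed_bigcup => [|x _]; first exact: finite_seq.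
  exact: closed_closure.
have VT n A : V n A -> A <> setT.
  move=> [[|x s] [//= _ _ ->]] AT; suff : (~` finite_closure (x :: s)) x.
    by apply; exists x; rewrite /= ?mem_head //; exact: closure_point.
  by rewrite AT.
have OV n : OB (V n).
  split=> [A /Vopen //|/VT //|B BBB].
  have [s [sn ds Bs]] := disjoint_closures_avoiding OU n.+1 BBB.
  by exists (~` finite_closure s); [exists s|apply/disjoints_subset].
have Vdisj A : exists M, forall n, V n A -> (n < M)%N.
  have [[n [s [sn _ As]]]|no] := pselect (exists n, V n A).
    exists n.+1 => m [t [tm dt At]].
    rewrite -sn -tm; apply: disjoint_closures_size_le => //.
    by apply: setC_inj; rewrite -At.
  by exists 0 => n VA; case: no; exists n.
have [O Oev OVk] := alpha4_selection OV Vdisj.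
exists O; split=> // k; have [n VO _] := OVk k; first exact: Vopen VO.
exact: VT VO.
Qed.

Lemma common_refinement (U : nat -> set (set X)) : (forall n, OB (U n)) ->
  forall n B, BB B -> exists A, [/\ open A, B `<=` A &
    forall i, (i < n)%N -> exists2 C, U i C & A `<=` C].
Proof.
move=> OU n B BBB; elim: n => [|n [A [Ao BA Aref]]].
  by exists setT; split=> //; exact: openT.
have [Uo _ Uc] := OU n; have [C UC BC] := Uc _ BBB.
exists (A `&` C); split=> [||i].
- by apply: openI => //; exact: Uo.
- by rewrite subsetI.
- rewrite ltnS leq_eqVlt => /predU1P[->|/Aref [D UD AD]].
    by exists C => // x [].
  by exists D => // x [/AD].
Qed.

(** Requiring [d 0], ..., [d n] in the members of the [n]-th refined cover makes
each set lie in finitely many of these covers, while the refinement allows a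
set selected from any cover of index at least [k] to be replaced by a
member of [U k]. *)
Lemma alpha4_S1 : S1 OB (Bsequence BB).
Proof.
move=> U OU.
have [O [Oo OT Oev]] := alpha4_countable_cover (OU 0).
have [d nOd] := choice (fun k => not_setT_missed (OT k)).
pose V n : set (set X) := [set A | [/\ open A, exists m, A `<=` O m,
  forall i, (i < n.+1)%N -> exists2 C, U i C & A `<=` C &
  forall i, (i < n.+1)%N -> A (d i)]].
have OV n : OB (V n).
  split=> [A [] //|[_ [m Om] _ _]|B BBB].
    by apply: (OT m); apply/seteqP.
  have dfin : BB (d @` `I_n.+1).
    by apply: (bornology_finite hBB (d 0)); exact: finite_image (finite_II _).
  have BBF := bornology_setU hBB BBB dfin.
  have [A [Ao FA Aref]] := common_refinement OU n.+1 BBF.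
  have [m /(_ m (leqnn _)) FO] := Oev _ BBF.
  exists (A `&` O m); last by move=> x Bx; split; [apply: FA|apply: FO]; left.
  split=> [||i /Aref [C UC AC]|i ltin].
  - exact: openI.
  - by exists m => x [].
  - by exists C => // x [/AC].
  - by split; [apply: FA|apply: FO]; right; exists i.
have Vfin A : exists M, forall n, V n A -> (n < M)%N.
  have [[m AO]|no] := pselect (exists m, A `<=` O m).
    exists m => n [_ _ _ Ad]; rewrite ltnNge; apply/negP => mn.
    by apply: (nOd m); apply: AO; exact: Ad.
  by exists 0 => n [].
have [A Aev AV] := alpha4_selection OV Vfin.
have coarse k : exists C, U k C /\ A k `<=` C.
  have [n [_ _ Aref _] kn] := AV k.
  by have [C UC AC] := Aref k kn; exists C.
have [C HC] := choice coarse.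
have UC k := (HC k).1.
exists C => //; apply: (selection_Bsequence hBB OU UC) => B /Aev [n0 Hn0].
by exists n0 => k /Hn0 BA x /BA; exact: (HC k).2.
Qed.

End Alpha4.

Theorem theorem3p23 (X : topologicalType) (BB : set (set X))
    (hBB : bornology BB) (hcl : has_closed_base BB) :
  [<-> alpha2 (open_Bcovers BB) (Bsequence_families BB);
       alpha3 (open_Bcovers BB) (Bsequence_families BB);
       alpha4 (open_Bcovers BB) (Bsequence_families BB);
       S1 (open_Bcovers BB) (Bsequence BB);
       ~ ONE_has_winning_strategy_G1 (open_Bcovers BB) (Bsequence BB);
       cap_infty (open_Bcovers BB) (Bsequence BB)].
Proof.
tfae.
- move=> A2 U /A2 [V FV Vinf]; exists V => //.
  rewrite (_ : [set n | _] = setT); first exact: infinite_nat.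
  by apply/seteqP; split=> n // _; exact: Vinf.
- move=> A3 U /A3 [V FV Vinf]; exists V => //.
  by apply: sub_infinite_set Vinf => n /infinite_setN0.
- exact: (alpha4_S1 hBB hcl).
- exact: (S1_ONE_has_no_winning_strategy hBB).
- by move=> /ONE_has_no_winning_strategy_S1; exact: (S1_cap_infty hBB).
- by move=> /(cap_infty_S1 hBB); exact: (S1_alpha2 hBB).
Qed.
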